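(* Let $\mathfrak{g}:[0,1]\to\mathbb{R}$ be differentiable, and consider the functional $$J(y)=\int_0^1 f(y(t),\dot y(t))\,dt,\qquad f(x,\dot x)=\dot x^2\,\mathfrak{g}(x).$$ Let $x:[0,1]\to[0,1]$ be a (twice differentiable) solution of the Euler--Lagrange equation $$\frac{\partial f}{\partial x}-\frac{d}{dt}\left(\frac{\partial f}{\partial\dot x}\right)=0$$ satisfying the boundary conditions $x(0)=0$ and $x(1)=1$, and suppose that $\mathfrak{g}(x(t))>0$ for all $t\in[0,1]$. Then $x$ is globally minimal for $J$, i.e. $J(x)\le J(y)$ for every $y\in\mathcal{T}$.
   Context: A dot denotes $d/dt$. $\mathcal{T}$ denotes the temporal reparameterization group: the set of all smooth monotonically increasing functions $\tau:[0,1]\to[0,1]$ with smooth inverse (so $\tau(0)=0$, $\tau(1)=1$), a group under composition. In the Euler--Lagrange equation, the partial derivatives of $f$ are evaluated at $(x(t),\dot x(t))$; for this $f$ the equation reads $2\ddot x\,\mathfrak{g}(x)+\dot x^2\,\mathfrak{g}'(x)=0$. *)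

(* Defs.v *)
From Stdlib Require Import Reals Lra.
From Coquelicot Require Import Coquelicot.
Open Scope R_scope.

Definition I01 (t : R) : Prop := 0 <= t <= 1.

(* A function on [0,1] is represented by a function on R of which only the
   values on [0,1] matter.  Derivatives are therefore taken within [0,1]: they
   are two-sided at interior points and one-sided at 0 and at 1.  The definition
   is Coquelicot's [is_derive] with [locally t] restricted to [0,1]. *)
Definition is_derive01 (f : R -> R) (t l : R) : Prop :=
  filterdiff f (within I01 (locally t)) (fun h : R => scal h l).

Definition ex_derive01 (f : R -> R) (t : R) : Prop :=
  exists l : R, is_derive01 f t l.

(* Meaningful when [I01 t] and [ex_derive01 f t], see [is_derive01_unique]. *)
Definition Derive01 (f : R -> R) (t : R) : R := iota (is_derive01 f t).

Fixpoint Derive01_n (f : R -> R) (n : nat) : R -> R :=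
  match n with
  | O => f
  | S m => Derive01 (Derive01_n f m)
  end.

Definition differentiable01 (f : R -> R) : Prop :=
  forall t : R, I01 t -> ex_derive01 f t.

Definition twice_differentiable01 (f : R -> R) : Prop :=
  differentiable01 f /\ differentiable01 (Derive01 f).

Definition smooth01 (f : R -> R) : Prop :=
  forall n : nat, differentiable01 (Derive01_n f n).

Definition maps01 (f : R -> R) : Prop := forall t : R, I01 t -> I01 (f t).

Definition temporal_reparam (tau : R -> R) : Prop :=
  maps01 tau /\
  (forall s t : R, I01 s -> I01 t -> s < t -> tau s < tau t) /\
  smooth01 tau /\
  exists sigma : R -> R,
    maps01 sigma /\ smooth01 sigma /\
    (forall t : R, I01 t -> sigma (tau t) = t) /\
    (forall t : R, I01 t -> tau (sigma t) = t).

Definition functional (f : R -> R -> R) (y : R -> R) : R :=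
  RInt (fun t => f (y t) (Derive01 y t)) 0 1.

(* In [f u v] the position [u] ranges over [0,1] and the velocity [v] over R, so
   the partial derivative in [u] is taken within [0,1]. *)
Definition partial_pos (f : R -> R -> R) (u v : R) : R :=
  Derive01 (fun u' => f u' v) u.

Definition partial_vel (f : R -> R -> R) (u v : R) : R :=
  Derive (fun v' => f u v') v.

Definition Euler_Lagrange (f : R -> R -> R) (x : R -> R) : Prop :=
  forall t : R, I01 t ->
    partial_pos f (x t) (Derive01 x t)
    - Derive01 (fun s => partial_vel f (x s) (Derive01 x s)) t = 0.

Definition lagrangian (g : R -> R) (u v : R) : R := v ^ 2 * g u.

Lemma within_I01_proper (t : R) :
  I01 t -> ProperFilter (within I01 (locally t)).
Proof.
intros Ht; split; [|apply within_filter, locally_filter].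
intros P HP; exists t; exact (locally_singleton _ _ HP Ht).
Qed.

Lemma is_derive01_ball (f : R -> R) (t l : R) : I01 t ->
  (is_derive01 f t l <->
   forall eps : posreal, exists d : posreal, forall s : R,
     I01 s -> Rabs (s - t) < d ->
     Rabs (f s - f t - (s - t) * l) <= eps * Rabs (s - t)).
Proof.
intros Ht; split.
- intros [_ H] eps.
  assert (Hl : is_filter_lim (within I01 (locally t)) t).
  { intros P HP; exact (filter_imp P _ (fun s Ps _ => Ps) HP). }
  destruct (H t Hl eps) as [d Hd]; exists d; intros s Hs Hst.
  exact (Hd s Hst Hs).
- intros H; split; [exact (is_linear_scal_l (K := R_AbsRing) (V := R_NormedModule) l)|].
  intros s Hs eps.
  assert (Est : t = s).
  { apply (@is_filter_lim_unique R_AbsRing R_NormedModule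
             (within I01 (locally t)) (Proper_StrongProper _ (within_I01_proper t Ht))); [|exact Hs].
    intros P HP; exact (filter_imp P _ (fun s Ps _ => Ps) HP). }
  subst s; destruct (H eps) as [d Hd]; exists d; intros s Hst Hs1.
  exact (Hd s Hs1 Hst).
Qed.

Lemma is_derive01_inj (f : R -> R) (t l1 l2 : R) :
  I01 t -> is_derive01 f t l1 -> is_derive01 f t l2 -> l1 = l2.
Proof.
intros Ht H1 H2; rewrite (is_derive01_ball _ _ _ Ht) in H1.
rewrite (is_derive01_ball _ _ _ Ht) in H2.
destruct (Req_dec l1 l2) as [|Hne]; [assumption|exfalso].
assert (Hp : 0 < Rabs (l1 - l2) / 4).
{ assert (0 < Rabs (l1 - l2)) by (apply Rabs_pos_lt; lra); lra. }
destruct (H1 (mkposreal _ Hp)) as [d1 Hd1].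
destruct (H2 (mkposreal _ Hp)) as [d2 Hd2]; simpl in Hd1, Hd2.
assert (Hs : exists s, I01 s /\ s <> t /\ Rabs (s - t) < d1 /\ Rabs (s - t) < d2).
{ pose (d := Rmin (1 / 2) (Rmin d1 d2 / 2)).
  assert (Hd12 := cond_pos d1); assert (Hd22 := cond_pos d2).
  assert (Hm : 0 < Rmin d1 d2) by (apply Rmin_glb_lt; assumption).
  assert (Hd : 0 < d) by (apply Rmin_glb_lt; lra).
  assert (A1 := Rmin_l (1 / 2) (Rmin d1 d2 / 2)); fold d in A1.
  assert (A2 := Rmin_r (1 / 2) (Rmin d1 d2 / 2)); fold d in A2.
  assert (A3 := Rmin_l d1 d2); assert (A4 := Rmin_r d1 d2).
  unfold I01 in *; destruct (Rle_dec t (1 / 2)).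
  - exists (t + d); replace (t + d - t) with d by ring.
    rewrite Rabs_pos_eq by lra; lra.
  - exists (t - d); replace (t - d - t) with (- d) by ring.
    rewrite Rabs_Ropp, Rabs_pos_eq by lra; lra. }
destruct Hs as [s [Is [Hst [B1 B2]]]].
specialize (Hd1 s Is B1); specialize (Hd2 s Is B2).
assert (C : Rabs ((s - t) * (l1 - l2))
            <= Rabs (f s - f t - (s - t) * l2) + Rabs (f s - f t - (s - t) * l1)).
{ replace ((s - t) * (l1 - l2))
    with ((f s - f t - (s - t) * l2) - (f s - f t - (s - t) * l1)) by ring.
  eapply Rle_trans; [apply Rabs_triang|]; rewrite Rabs_Ropp; lra. }
rewrite Rabs_mult in C.
assert (0 < Rabs (s - t)) by (apply Rabs_pos_lt; lra).
nra.
Qed.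

Lemma is_derive01_unique (f : R -> R) (t l : R) :
  I01 t -> is_derive01 f t l -> Derive01 f t = l.
Proof.
intros Ht Hl.
apply (@iota_unique R_AbsRing R_CompleteNormedModule); [|exact Hl].
intros l' Hl'; exact (is_derive01_inj f t l' l Ht Hl' Hl).
Qed.

(* Main.v *)
Require Import Defs.
From Stdlib Require Import Reals Lra.
From Coquelicot Require Import Coquelicot.
Open Scope R_scope.

(** Write [v] for the speed [x' * sqrt (g x)] of [x], measured in the metric
    [g(u) du^2].  The integrand of the functional is the square of the speed, so
    the functional is the energy of a path in a one-dimensional Riemannian
    manifold, and the theorem is the usual comparison of energy with length.

    The Euler-Lagrange equation says that the derivative
    [(2 x'' g + x'^2 g') / (2 sqrt g)] of [v] vanishes ([speed_constant]), so
    [v] is a constant [c] and the energy of [x] is [c^2].  Because [x] is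
    continuous and runs from 0 to 1, it takes every value in [[0,1]]; hence [g]
    is positive on the whole of [[0,1]], and [sqrt g] has a primitive there.  By
    the chain rule, every path from 0 to 1 has the same signed length, the
    integral of [sqrt g] over [[0,1]] ([length_of_path]); for [x] this length
    is [c].  Finally the speed [w] of a competitor satisfies
    [w^2 >= 2 c w - c^2] pointwise.  Integrating, its energy is at least
    [2 c c - c^2 = c^2] ([energy_ge_length]). *)

(** * Calculus within [[0,1]] *)

(** One-sided derivatives become two-sided ones after a suitable extension, so
    that the calculus rules within [[0,1]] follow from those on the line.  The
    extension may be taken affine outside [[0,1]], with slope [l] and through
    the point [(t, f t)]: there the error of linear approximation is zero. *)
Lemma is_derive01_extension (f : R -> R) (t l : R) : I01 t ->
  (is_derive01 f t l <->
   exists F : R -> R, (forall s, I01 s -> F s = f s) /\ is_derive F t l).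
Proof.
intros Ht; rewrite (is_derive01_ball _ _ _ Ht); split.
- intros H.
  assert (dec : forall s, {I01 s} + {~ I01 s}).
  { intros s; unfold I01.
    destruct (Rle_dec 0 s); destruct (Rle_dec s 1); (left; lra) || (right; lra). }
  exists (fun s => if dec s then f s else f t + (s - t) * l); split.
  + intros s Hs; destruct (dec s); [reflexivity | contradiction].
  + split; [exact (is_linear_scal_l (K := R_AbsRing) (V := R_NormedModule) l)|].
    intros u Hu eps.
    assert (t = u) as <- by exact (is_filter_lim_locally_unique _ _ Hu).
    destruct (H eps) as [d Hd]; exists d; intros s Hst.
    change (Rabs ((if dec s then f s else f t + (s - t) * l)
                  - (if dec t then f t else f t + (t - t) * l) - (s - t) * l)
            <= eps * Rabs (s - t)).
    destruct (dec t) as [_|]; [|contradiction].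
    destruct (dec s) as [Hs|_]; [exact (Hd s Hs Hst)|].
    replace (_ - _ - _) with 0 by ring; rewrite Rabs_R0.
    apply Rmult_le_pos; [apply Rlt_le, cond_pos | apply Rabs_pos].
- intros [F [HF [_ H]]] eps.
  destruct (H t (fun P HP => HP) eps) as [d Hd]; exists d; intros s Hs Hst.
  rewrite <- (HF s Hs), <- (HF t Ht); exact (Hd s Hst).
Qed.

Lemma is_derive_is_derive01 (f : R -> R) (t l : R) :
  I01 t -> is_derive f t l -> is_derive01 f t l.
Proof.
intros Ht H; apply is_derive01_extension; [exact Ht|].
exists f; split; [reflexivity | exact H].
Qed.

Lemma is_derive01_ext (f h : R -> R) (t l : R) : I01 t ->
  (forall s, I01 s -> f s = h s) -> is_derive01 f t l -> is_derive01 h t l.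
Proof.
intros Ht E; rewrite !is_derive01_extension by exact Ht.
intros [F [HF H]]; exists F; split; [|exact H].
intros s Hs; rewrite HF, E by exact Hs; reflexivity.
Qed.

Lemma is_derive01_mult (f h : R -> R) (t lf lh : R) : I01 t ->
  is_derive01 f t lf -> is_derive01 h t lh ->
  is_derive01 (fun s => f s * h s) t (lf * h t + f t * lh).
Proof.
intros Ht; rewrite !is_derive01_extension by exact Ht.
intros [F [EF HF]] [H [EH HH]]; exists (fun s => F s * H s); split.
- intros s Hs; rewrite EF, EH by exact Hs; reflexivity.
- rewrite <- (EF t Ht), <- (EH t Ht).
  exact (is_derive_mult F H t lf lh HF HH Rmult_comm).
Qed.

Lemma is_derive01_minus (f h : R -> R) (t lf lh : R) : I01 t ->
  is_derive01 f t lf -> is_derive01 h t lh ->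
  is_derive01 (fun s => f s - h s) t (lf - lh).
Proof.
intros Ht; rewrite !is_derive01_extension by exact Ht.
intros [F [EF HF]] [H [EH HH]]; exists (fun s => F s - H s); split.
- intros s Hs; rewrite EF, EH by exact Hs; reflexivity.
- exact (is_derive_minus F H t lf lh HF HH).
Qed.

Lemma is_derive01_comp_outer (h f : R -> R) (t lh lf : R) : I01 t ->
  is_derive h (f t) lh -> is_derive01 f t lf ->
  is_derive01 (fun s => h (f s)) t (lf * lh).
Proof.
intros Ht Hh; rewrite !is_derive01_extension by exact Ht.
intros [F [EF HF]]; exists (fun s => h (F s)); split.
- intros s Hs; rewrite EF by exact Hs; reflexivity.
- rewrite <- (EF t Ht) in Hh; exact (is_derive_comp h F t lh lf Hh HF).
Qed.

Lemma is_derive01_comp (h f : R -> R) (t lh lf : R) : I01 t -> maps01 f ->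
  is_derive01 h (f t) lh -> is_derive01 f t lf ->
  is_derive01 (fun s => h (f s)) t (lf * lh).
Proof.
intros Ht Hm Hh Hf.
apply is_derive01_extension in Hh; [|exact (Hm t Ht)].
destruct Hh as [H [EH HH]].
apply is_derive01_ext with (fun s => H (f s)); [exact Ht| |].
- intros s Hs; exact (EH _ (Hm s Hs)).
- exact (is_derive01_comp_outer H f t lh lf Ht HH Hf).
Qed.

Lemma Derive01_correct (f : R -> R) (t : R) :
  I01 t -> ex_derive01 f t -> is_derive01 f t (Derive01 f t).
Proof.
intros Ht [l Hl]; rewrite (is_derive01_unique f t l Ht Hl); exact Hl.
Qed.

(** * Continuity and the mean value theorem within [[0,1]] *)

Definition clamp (s : R) : R := Rmax 0 (Rmin 1 s).

Lemma clamp_I01 (s : R) : I01 (clamp s).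
Proof.
unfold clamp, I01; split; [apply Rmax_l|].
apply Rmax_lub; [lra | apply Rmin_l].
Qed.

Lemma clamp_id (s : R) : I01 s -> clamp s = s.
Proof.
intros [H0 H1]; unfold clamp; rewrite Rmin_right, Rmax_right; lra.
Qed.

Lemma continuous_clamp (s : R) : continuous clamp s.
Proof.
apply continuous_ext with (fun u =>
    (1 + u - Rabs (u - 1) + Rabs (1 + u - Rabs (u - 1))) / 4).
- intros u; unfold clamp, Rmax, Rmin.
  destruct (Rle_dec 1 u); destruct (Rle_dec 0 _); unfold Rabs;
    repeat destruct (Rcase_abs _); lra.
- apply continuity_pt_filterlim; reg; apply Rcontinuity_abs.
Qed.

(** The values outside [[0,1]] are arbitrary; clamping the argument turns
    continuity within [[0,1]] into ordinary continuity on the line, as the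
    integration and intermediate value theorems want it. *)
Definition continuous01 (f : R -> R) : Prop :=
  forall t : R, continuous (fun s => f (clamp s)) t.

Lemma differentiable01_continuous01 (f : R -> R) :
  differentiable01 f -> continuous01 f.
Proof.
intros Hf t; destruct (Hf _ (clamp_I01 t)) as [l Hl].
apply is_derive01_extension in Hl; [|apply clamp_I01].
destruct Hl as [F [EF HF]].
apply continuous_ext with (fun s => F (clamp s)).
- intros s; apply EF, clamp_I01.
- apply continuous_comp; [apply continuous_clamp|].
  apply @ex_derive_continuous; exists l; exact HF.
Qed.

Lemma continuous01_mult (f h : R -> R) :
  continuous01 f -> continuous01 h -> continuous01 (fun s => f s * h s).
Proof.
intros Hf Hh t.
exact (continuous_mult (fun s => f (clamp s)) (fun s => h (clamp s)) t (Hf t) (Hh t)).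
Qed.

Lemma continuous01_comp (h f : R -> R) : maps01 f ->
  continuous01 h -> continuous01 f -> continuous01 (fun s => h (f s)).
Proof.
intros Hm Hh Hf t.
apply continuous_ext with (fun s => h (clamp (f (clamp s)))).
- intros s; rewrite (clamp_id (f _)); [reflexivity | apply Hm, clamp_I01].
- exact (continuous_comp _ (fun u => h (clamp u)) t (Hf t) (Hh _)).
Qed.

Lemma continuous01_sqrt (f : R -> R) :
  continuous01 f -> continuous01 (fun s => sqrt (f s)).
Proof.
intros Hf t; exact (continuous_comp _ sqrt t (Hf t) (continuous_sqrt _)).
Qed.

Lemma ex_RInt_continuous01 (f : R -> R) : continuous01 f -> ex_RInt f 0 1.
Proof.
intros Hf; apply ex_RInt_ext with (fun s => f (clamp s)).
- intros s; rewrite Rmin_left, Rmax_right by lra; intros Hs.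
  rewrite clamp_id; [reflexivity | unfold I01; lra].
- apply @ex_RInt_continuous; intros s _; apply Hf.
Qed.

Lemma surjective01 (f : R -> R) : continuous01 f -> f 0 = 0 -> f 1 = 1 ->
  forall u, I01 u -> exists t, I01 t /\ f t = u.
Proof.
intros Hf f0 f1 u Hu.
destruct (IVT_gen (fun s => f (clamp s)) 0 1 u) as [t [Ht Et]].
- intros s; apply continuity_pt_filterlim, Hf.
- rewrite !clamp_id, f0, f1 by (unfold I01; lra).
  rewrite Rmin_left, Rmax_right by lra; exact Hu.
- rewrite Rmin_left, Rmax_right in Ht by lra.
  rewrite clamp_id in Et by exact Ht; exists t; split; assumption.
Qed.

Lemma derive01_zero_constant (f : R -> R) :
  (forall t, I01 t -> is_derive01 f t 0) -> forall t, I01 t -> f t = f 0.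
Proof.
intros Hf t Ht.
assert (Hc : continuous01 f)
  by (apply differentiable01_continuous01; intros s Hs; exists 0; exact (Hf s Hs)).
destruct (MVT_gen (fun s => f (clamp s)) 0 t (fun _ => 0)) as [c [_ Hc0]].
- intros s; rewrite Rmin_left, Rmax_right by apply Ht; intros Hs.
  assert (Hs01 : I01 s) by (unfold I01 in *; lra).
  destruct (proj1 (is_derive01_extension f s 0 Hs01) (Hf s Hs01)) as [F [EF HF]].
  apply is_derive_ext_loc with F; [|exact HF].
  apply locally_interval with 0 1; simpl; [apply Hs | unfold I01 in *; lra |].
  intros u H0 H1; assert (Hu : I01 u) by (unfold I01; lra).
  rewrite (clamp_id u Hu); exact (EF u Hu).
- intros s _; apply continuity_pt_filterlim, Hc.
- rewrite !clamp_id in Hc0 by (exact Ht || (unfold I01; lra)); lra.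
Qed.

(** * Integration within [[0,1]] *)

Definition primitive01 (f : R -> R) (t : R) : R :=
  RInt (fun s => f (clamp s)) 0 t.

Lemma is_derive_primitive01 (f : R -> R) (t : R) : continuous01 f ->
  is_derive (primitive01 f) t (f (clamp t)).
Proof.
intros Hf.
apply (@is_derive_RInt R_CompleteNormedModule (fun s => f (clamp s)) _ 0 t); [|apply Hf].
apply filter_forall; intros s; apply @RInt_correct, @ex_RInt_continuous.
intros u _; apply Hf.
Qed.

Lemma RInt_derive01 (F f : R -> R) : continuous01 f ->
  (forall t, I01 t -> is_derive01 F t (f t)) -> RInt f 0 1 = F 1 - F 0.
Proof.
intros Hc HF.
assert (E : F 1 - primitive01 f 1 = F 0 - primitive01 f 0).
{ apply (derive01_zero_constant (fun s => F s - primitive01 f s)); [|unfold I01; lra].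
  intros t Ht; replace 0 with (f t - f (clamp t)) by (rewrite (clamp_id t Ht); ring).
  apply is_derive01_minus; [exact Ht | exact (HF t Ht) |].
  apply is_derive_is_derive01; [exact Ht | exact (is_derive_primitive01 f t Hc)]. }
assert (E0 : primitive01 f 0 = 0) by (apply @RInt_point).
assert (E1 : primitive01 f 1 = RInt f 0 1).
{ apply RInt_ext; intros s; rewrite Rmin_left, Rmax_right by lra; intros Hs.
  rewrite clamp_id; [reflexivity | unfold I01; lra]. }
lra.
Qed.

(** * Speed, length and energy of a path *)

(** The velocity of [y] measured in the Riemannian metric [g(u) du^2]; its
    integral is the signed length of [y]. *)
Definition speed (g y : R -> R) (t : R) : R := Derive01 y t * sqrt (g (y t)).

Lemma speed_continuous (g y : R -> R) : continuous01 g -> maps01 y ->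
  twice_differentiable01 y -> continuous01 (speed g y).
Proof.
intros Hg Hm [Hy Hy']; apply continuous01_mult.
- exact (differentiable01_continuous01 _ Hy').
- apply continuous01_sqrt, continuous01_comp; [exact Hm | exact Hg |].
  exact (differentiable01_continuous01 _ Hy).
Qed.

Lemma lagrangian_speed (g y : R -> R) (t : R) : 0 <= g (y t) ->
  lagrangian g (y t) (Derive01 y t) = speed g y t * speed g y t.
Proof.
intros H; unfold lagrangian, speed.
rewrite <- (sqrt_sqrt (g (y t)) H) at 1; ring.
Qed.

(** The chain rule makes the speed the derivative of [P (y t)], where [P] is a
    primitive of [sqrt g]; hence the length depends on the end points only. *)
Lemma length_of_path (g y : R -> R) : continuous01 g -> maps01 y ->
  twice_differentiable01 y -> y 0 = 0 -> y 1 = 1 ->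
  RInt (speed g y) 0 1
  = primitive01 (fun u => sqrt (g u)) 1 - primitive01 (fun u => sqrt (g u)) 0.
Proof.
intros Hg Hm Hy y0 y1.
rewrite (RInt_derive01 (fun t => primitive01 (fun u => sqrt (g u)) (y t))).
- rewrite y0, y1; reflexivity.
- exact (speed_continuous g y Hg Hm Hy).
- intros t Ht; apply is_derive01_comp_outer; [exact Ht | |].
  + rewrite <- (clamp_id (y t) (Hm t Ht)) at 2.
    exact (is_derive_primitive01 (fun u => sqrt (g u)) (y t) (continuous01_sqrt g Hg)).
  + exact (Derive01_correct y t Ht (proj1 Hy t Ht)).
Qed.

Lemma partial_pos_lagrangian (g : R -> R) (u v : R) : I01 u -> ex_derive01 g u ->
  partial_pos (lagrangian g) u v = v ^ 2 * Derive01 g u.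
Proof.
intros Hu Hg; apply is_derive01_unique; [exact Hu|].
replace (v ^ 2 * Derive01 g u) with (Derive01 g u * v ^ 2) by ring.
apply (is_derive01_comp_outer (fun w => v ^ 2 * w)); [exact Hu | |].
- auto_derive; [exact I | ring].
- exact (Derive01_correct g u Hu Hg).
Qed.

Lemma partial_vel_lagrangian (g : R -> R) (u v : R) :
  partial_vel (lagrangian g) u v = 2 * v * g u.
Proof.
apply is_derive_unique; unfold lagrangian; auto_derive; [exact I | ring].
Qed.

Lemma Euler_Lagrange_lagrangian (g x : R -> R) (t : R) :
  differentiable01 g -> maps01 x -> twice_differentiable01 x ->
  Euler_Lagrange (lagrangian g) x -> I01 t ->
  2 * Derive01 (Derive01 x) t * g (x t) + Derive01 x t ^ 2 * Derive01 g (x t) = 0.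
Proof.
intros Hg Hm [Hx Hx'] EL Ht; specialize (EL t Ht).
rewrite partial_pos_lagrangian in EL; [|exact (Hm t Ht) | exact (Hg _ (Hm t Ht))].
assert (Hp : is_derive01
  (fun s => partial_vel (lagrangian g) (x s) (Derive01 x s)) t
  ((Derive01 (Derive01 x) t * g (x t)
    + Derive01 x t * (Derive01 x t * Derive01 g (x t))) * 2)).
{ apply is_derive01_ext with (fun s => 2 * (Derive01 x s * g (x s))); [exact Ht | |].
  - intros s _; rewrite partial_vel_lagrangian; ring.
  - apply (is_derive01_comp_outer (fun w => 2 * w) (fun s => Derive01 x s * g (x s)));
      [exact Ht | |].
    + auto_derive; [exact I | ring].
    + apply (is_derive01_mult (Derive01 x) (fun s => g (x s))); [exact Ht | |].
      * exact (Derive01_correct _ t Ht (Hx' t Ht)).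
      * apply (is_derive01_comp g x); [exact Ht | exact Hm | |].
        -- exact (Derive01_correct g _ (Hm t Ht) (Hg _ (Hm t Ht))).
        -- exact (Derive01_correct x t Ht (Hx t Ht)). }
rewrite (is_derive01_unique _ _ _ Ht Hp) in EL; lra.
Qed.

(** Solutions of the Euler-Lagrange equation are the geodesics: after division
    by [2 * sqrt g], the equation says that the speed has derivative zero. *)
Lemma speed_constant (g x : R -> R) :
  differentiable01 g -> maps01 x -> twice_differentiable01 x ->
  Euler_Lagrange (lagrangian g) x -> (forall t, I01 t -> 0 < g (x t)) ->
  forall t, I01 t -> speed g x t = speed g x 0.
Proof.
intros Hg Hm Hx EL Hpos; apply derive01_zero_constant; intros t Ht.
assert (E := Euler_Lagrange_lagrangian g x t Hg Hm Hx EL Ht).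
destruct Hx as [Hx Hx'].
assert (Hs := sqrt_lt_R0 _ (Hpos t Ht)).
replace 0 with
  (Derive01 (Derive01 x) t * sqrt (g (x t))
   + Derive01 x t * (Derive01 x t * Derive01 g (x t) * / (2 * sqrt (g (x t))))).
- apply (is_derive01_mult (Derive01 x) (fun s => sqrt (g (x s))));
    [exact Ht | exact (Derive01_correct _ t Ht (Hx' t Ht)) |].
  apply (is_derive01_comp_outer sqrt (fun s => g (x s))); [exact Ht | |].
  + auto_derive; [exact (Hpos t Ht) | field; lra].
  + apply (is_derive01_comp g x); [exact Ht | exact Hm | |].
    * exact (Derive01_correct g _ (Hm t Ht) (Hg _ (Hm t Ht))).
    * exact (Derive01_correct x t Ht (Hx t Ht)).
- rewrite <- (sqrt_sqrt (g (x t))) in E by (apply Rlt_le, Hpos, Ht).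
  apply Rmult_eq_reg_r with (2 * sqrt (g (x t))); [|lra].
  rewrite Rmult_0_l, <- E; field; lra.
Qed.

Lemma temporal_reparam_endpoints (y : R -> R) :
  temporal_reparam y -> y 0 = 0 /\ y 1 = 1.
Proof.
intros [Hm [Hinc [_ [sigma [Hs [_ [_ Hys]]]]]]].
assert (H0 : I01 0) by (unfold I01; lra).
assert (H1 : I01 1) by (unfold I01; lra).
assert (A0 := Hs 0 H0); assert (A1 := Hs 1 H1).
assert (E0 := Hys 0 H0); assert (E1 := Hys 1 H1).
assert (B0 := Hm 0 H0); assert (B1 := Hm 1 H1).
split.
- destruct (Rle_lt_or_eq_dec 0 (sigma 0) (proj1 A0)) as [L | E].
  + specialize (Hinc _ _ H0 A0 L); unfold I01 in *; lra.
  + rewrite E at 1; exact E0.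
- destruct (Rle_lt_or_eq_dec (sigma 1) 1 (proj2 A1)) as [L | E].
  + specialize (Hinc _ _ A1 H1 L); unfold I01 in *; lra.
  + rewrite <- E at 1; exact E1.
Qed.

(** Integrating [0 <= (w - c)^2], where [w] is the speed. *)
Lemma energy_ge_length (g y : R -> R) (c : R) : continuous01 g -> maps01 y ->
  twice_differentiable01 y -> (forall t, I01 t -> 0 <= g (y t)) ->
  2 * c * RInt (speed g y) 0 1 - c * c <= functional (lagrangian g) y.
Proof.
intros Hg Hm Hy Hpos; unfold functional.
assert (Hw := speed_continuous g y Hg Hm Hy).
rewrite (RInt_ext (fun t => lagrangian g (y t) (Derive01 y t))
  (fun t => speed g y t * speed g y t)).
2:{ intros t; rewrite Rmin_left, Rmax_right by lra; intros Ht.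
    apply lagrangian_speed, Hpos; unfold I01; lra. }
assert (I1 := is_RInt_scal _ _ _ (2 * c) _
  (RInt_correct _ _ _ (ex_RInt_continuous01 _ Hw))).
assert (I2 := is_RInt_minus _ _ _ _ _ _ I1 (is_RInt_const 0 1 (c * c))).
replace (2 * c * RInt (speed g y) 0 1 - c * c)
  with (2 * c * RInt (speed g y) 0 1 - (1 - 0) * (c * c)) by ring.
refine (is_RInt_le _ _ 0 1 _ _ Rle_0_1 I2
  (RInt_correct _ _ _ (ex_RInt_continuous01 _ (continuous01_mult _ _ Hw Hw))) _).
intros t _.
change (2 * c * speed g y t - c * c <= speed g y t * speed g y t).
assert (0 <= (speed g y t - c) ^ 2) by apply pow2_ge_0; lra.
Qed.

(** * Minimality of the geodesic *)

Theorem theorem1 : forall (g x : R -> R),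
  differentiable01 g ->
  maps01 x ->
  twice_differentiable01 x ->
  Euler_Lagrange (lagrangian g) x ->
  x 0 = 0 ->
  x 1 = 1 ->
  (forall t : R, I01 t -> 0 < g (x t)) ->
  forall y : R -> R, temporal_reparam y ->
    functional (lagrangian g) x <= functional (lagrangian g) y.
Proof.
intros g x Hg Hm Hx EL x0 x1 Hpos y Hy.
destruct (temporal_reparam_endpoints y Hy) as [y0 y1].
destruct Hy as [Hmy [_ [Hsmooth _]]].
assert (Hy : twice_differentiable01 y) by exact (conj (Hsmooth 0%nat) (Hsmooth 1%nat)).
assert (Hcg := differentiable01_continuous01 g Hg).
assert (Hgpos : forall u, I01 u -> 0 < g u).
{ intros u Hu.
  destruct (surjective01 x (differentiable01_continuous01 x (proj1 Hx)) x0 x1 u Hu)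
    as [t [Ht <-]]; exact (Hpos t Ht). }
assert (Hc := speed_constant g x Hg Hm Hx EL Hpos).
set (c := speed g x 0) in Hc.
assert (Hlength : RInt (speed g y) 0 1 = c).
{ rewrite (length_of_path g y Hcg Hmy Hy y0 y1),
    <- (length_of_path g x Hcg Hm Hx x0 x1).
  rewrite (RInt_ext _ (fun _ => c)).
  - rewrite RInt_const; unfold scal; simpl; unfold mult; simpl; ring.
  - intros t; rewrite Rmin_left, Rmax_right by lra; intros Ht.
    apply Hc; unfold I01; lra. }
assert (Henergy : functional (lagrangian g) x = c * c).
{ unfold functional; rewrite (RInt_ext _ (fun _ => c * c)).
  - rewrite RInt_const; unfold scal; simpl; unfold mult; simpl; ring.
  - intros t; rewrite Rmin_left, Rmax_right by lra; intros Ht.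
    assert (Ht01 : I01 t) by (unfold I01; lra).
    rewrite lagrangian_speed, Hc by (exact Ht01 || apply Rlt_le, Hpos, Ht01).
    reflexivity. }
assert (H := energy_ge_length g y c Hcg Hmy Hy
  (fun t Ht => Rlt_le _ _ (Hgpos _ (Hmy t Ht)))).
rewrite Hlength in H; lra.
Qed.
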